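(* Let $X$ be a finitely determined and finitely shrinking sequence class. (a) $\Pi_{X;Y}\stackrel{1}{=}\Pi_{X^u;Y}$ for every finitely determined sequence class $Y$. (b) $\Pi_{X;Y}\stackrel{1}{=}\Pi_{X^u;Y^u}$ for every finitely determined and finitely shrinking sequence class $Y$. (c) $\Pi_{X^u;Y^u}=\Pi_{X;Y^{\rm fd}}\stackrel{1}{=}\Pi_{X^u;Y^{\rm fd}}$ for every finitely shrinking and finitely zero invariant sequence class $Y$.
   Context: Banach spaces are over $\mathbb{K}=\mathbb{R}$ or $\mathbb{C}$; $\mathcal{L}(E;F)$ is the space of continuous linear operators. $c_{00}(E)$ and $\ell_\infty(E)$ are the spaces of eventually null and of bounded $E$-valued sequences (the latter with the sup norm). $E\stackrel{1}{\hookrightarrow}F$ means that $E$ is a linear subspace of $F$ and $\|\cdot\|_F\le\|\cdot\|_E$ on $E$. $(x_j)_{j=1}^k$ also denotes the sequence $(x_1,\ldots,x_k,0,0,\ldots)$, and $(x_j)_{j\ne k}:=(x_1,\ldots,x_{k-1},x_{k+1},\ldots)$. Sequence class: a rule $X$ assigning to each Banach space $E$ a Banach space $X(E)$ of $E$-valued sequences such that $c_{00}(E)\subseteq X(E)\stackrel{1}{\hookrightarrow}\ell_\infty(E)$ and $\|e_j\|_{X(\mathbb{K})}=1$ for every $j\in\mathbb{N}$, where $e_j$ is the $j$-th canonical unit scalar sequence. Given sequence classes $X,Y$, an operator $T\in\mathcal{L}(E;F)$ is $(X;Y)$-summing, written $T\in\Pi_{X;Y}(E;F)$, if $(T(x_j))_{j=1}^\infty\in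 Y(F)$ whenever $(x_j)_{j=1}^\infty\in X(E)$. Its norm $\|T\|_{X;Y}$ is the norm of the induced continuous linear operator $X(E)\to Y(F)$. For such classes of operators, $=$ means equality of the components for all Banach spaces $E,F$, and $\stackrel{1}{=}$ means equality of components with equal norms. Standing assumptions: every sequence class $X$ is linearly stable, i.e. $\Pi_{X;X}(E;F)=\mathcal{L}(E;F)$ with equal norms for all Banach spaces $E,F$; and whenever $\Pi_{X;Y}$ is considered, it is assumed that $X(\mathbb{K})\stackrel{1}{\hookrightarrow}Y(\mathbb{K})$ (so that $\Pi_{X;Y}$ is a Banach operator ideal). $X$ is finitely determined if, for every Banach space $E$ and every $(x_j)_{j=1}^\infty\in E^{\mathbb{N}}$, $(x_j)_{j=1}^\infty\in X(E)$ if and only if $\sup_k\|(x_j)_{j=1}^k\|_{X(E)}<\infty$, and in this case $\|(x_j)_{j=1}^\infty\|_{X(E)}=\sup_k\|(x_j)_{j=1}^k\|_{X(E)}$. $X$ is finitely shrinking if, for every $E$, $(x_j)_{j=1}^\infty\in X(E)$ and $k\in\mathbb{N}$, $(x_j)_{j\ne k}\in X(E)$ and $\|(x_j)_{j\ne k}\|_{X(E)}\le\|(x_j)_{j=1}^\infty\|_{X(E)}$. $X$ is finitely zero invariant if, for all $E$, all sequences $(x_j)_{j=1}^\infty$ in $E$ and all $k\in\mathbb{N}$ for which $x_k=0$: $(x_j)_{j=1}^\infty\in X(E)$ if and only if $(x_j)_{j\ne k}\in X(E)$, and in this case $\|(x_j)_{j=1}^\infty\|_{X(E)}=\|(x_j)_{j\ne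 k}\|_{X(E)}$. For $X$ finitely shrinking, $X^u(E)=\{(x_j)_{j=1}^\infty\in X(E):\lim_n\|(x_n,x_{n+1},\ldots)\|_{X(E)}=0\}$ with the norm $\|\cdot\|_{X(E)}$. For any sequence class $X$, $X^{\rm fd}(E):=\{(x_j)_{j=1}^\infty\in E^{\mathbb{N}}:\|(x_j)_{j=1}^\infty\|_{X^{\rm fd}(E)}:=\sup_k\|(x_j)_{j=1}^k\|_{X(E)}<\infty\}$. Both are (linearly stable) sequence classes. *)

(* Defs.v *)
(* Stdlib real numbers with Coquelicot's normed modules. *)
From Stdlib Require Import Reals.
From Coquelicot Require Import Coquelicot.

Set Implicit Arguments.
Unset Strict Implicit.

Open Scope R_scope.

Inductive scalar_field : Set := Real_scalars | Complex_scalars.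

Definition ring_of (k : scalar_field) : AbsRing :=
  match k with Real_scalars => R_AbsRing | Complex_scalars => C_AbsRing end.

Definition banach (k : scalar_field) := CompleteNormedModule (ring_of k).

(* The scalar field as a Banach space over itself; its norm is Rabs, resp. Cmod. *)
Definition scalar_banach (k : scalar_field) : banach k :=
  match k with
  | Real_scalars => R_CompleteNormedModule
  | Complex_scalars => C_CompleteNormedModule
  end.

Definition scalar_one (k : scalar_field) : scalar_banach k :=
  match k return scalar_banach k with
  | Real_scalars => 1
  | Complex_scalars => RtoC 1
  end.

(* Sequences (x_1, x_2, ...) are functions on nat: x_(j+1) is [x j]. *)

Definition unit_seq (k : scalar_field) (j n : nat) : scalar_banach k :=
  if Nat.eqb n j then scalar_one k else zero.

Definition trunc {k : scalar_field} {E : banach k} (m : nat) (x : nat -> E) :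
    nat -> E :=
  fun n => if Nat.ltb n m then x n else zero.

Definition tail {k : scalar_field} {E : banach k} (m : nat) (x : nat -> E) :
    nat -> E :=
  fun n => x (m + n)%nat.

Definition delete {k : scalar_field} {E : banach k} (m : nat) (x : nat -> E) :
    nat -> E :=
  fun n => if Nat.ltb n m then x n else x (S n).

(* The data of a rule E |-> X(E): the sequences belonging to X(E) and their
   norm. The value of [snorm X x] is meaningless when x is not in X(E). *)
Record seq_rule (k : scalar_field) := SeqRule {
  smem : forall E : banach k, (nat -> E) -> Prop;
  snorm : forall E : banach k, (nat -> E) -> R
}.

Arguments SeqRule {k} _ _.
Arguments smem {k} _ {E} _.
Arguments snorm {k} _ {E} _.

Record banach_seq_space (k : scalar_field) (X : seq_rule k) (E : banach k) :
    Prop := {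
  bss_zero : smem X (fun _ => zero : E);
  bss_plus : forall x y : nat -> E, smem X x -> smem X y ->
    smem X (fun n => plus (x n) (y n));
  bss_scal : forall (a : ring_of k) (x : nat -> E), smem X x ->
    smem X (fun n => scal a (x n));
  bss_norm_ge0 : forall x : nat -> E, smem X x -> 0 <= snorm X x;
  bss_norm_eq0 : forall x : nat -> E, smem X x -> snorm X x = 0 ->
    forall n, x n = zero;
  bss_norm_triangle : forall x y : nat -> E, smem X x -> smem X y ->
    snorm X (fun n => plus (x n) (y n)) <= snorm X x + snorm X y;
  bss_norm_scal : forall (a : ring_of k) (x : nat -> E), smem X x ->
    snorm X (fun n => scal a (x n)) = abs a * snorm X x;
  bss_complete : forall u : nat -> nat -> E,
    (forall i, smem X (u i)) ->
    (forall eps, 0 < eps -> exists N, forall i j, (N <= i)%nat -> (N <= j)%nat ->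
       snorm X (fun n => minus (u i n) (u j n)) < eps) ->
    exists x : nat -> E, smem X x /\
      forall eps, 0 < eps -> exists N, forall i, (N <= i)%nat ->
        snorm X (fun n => minus (u i n) (x n)) < eps
}.

Definition linf (k : scalar_field) : seq_rule k :=
  SeqRule (fun E x => exists M : R, forall n, norm (x n) <= M)
          (fun E x => real (Sup_seq (fun n => Finite (norm (x n))))).

Definition embeds1 (k : scalar_field) (X Y : seq_rule k) (E : banach k) : Prop :=
  forall x : nat -> E, smem X x -> smem Y x /\ snorm Y x <= snorm X x.

Definition eventually_null {k : scalar_field} {E : banach k} (x : nat -> E) :
    Prop :=
  exists N, forall n, (N <= n)%nat -> x n = zero.

Record sequence_class (k : scalar_field) (X : seq_rule k) : Prop := {
  sc_banach : forall E : banach k, banach_seq_space X E;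
  sc_c00 : forall (E : banach k) (x : nat -> E), eventually_null x -> smem X x;
  sc_linf : forall E : banach k, embeds1 X (linf k) E;
  sc_unit : forall j, snorm X (unit_seq k j) = 1
}.

Definition op_norm {k : scalar_field} {E F : banach k} (T : E -> F) : Rbar :=
  Lub_Rbar (fun r => exists x : E, norm x <= 1 /\ r = norm (T x)).

(* [is_linear] is Coquelicot's: additive, homogeneous and bounded, that is,
   T belongs to L(E;F). *)
Definition summing {k : scalar_field} (X Y : seq_rule k) {E F : banach k}
    (T : E -> F) : Prop :=
  is_linear T /\
  forall x : nat -> E, smem X x -> smem Y (fun j => T (x j)).

Definition summing_norm {k : scalar_field} (X Y : seq_rule k) {E F : banach k}
    (T : E -> F) : Rbar :=
  Lub_Rbar (fun r => exists x : nat -> E,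
    smem X x /\ snorm X x <= 1 /\ r = snorm Y (fun j => T (x j))).

Definition ideal_eq (k : scalar_field) (X Y X' Y' : seq_rule k) : Prop :=
  forall (E F : banach k) (T : E -> F), summing X Y T <-> summing X' Y' T.

Definition ideal_eq1 (k : scalar_field) (X Y X' Y' : seq_rule k) : Prop :=
  ideal_eq X Y X' Y' /\
  forall (E F : banach k) (T : E -> F), summing X Y T ->
    summing_norm X Y T = summing_norm X' Y' T.

Definition linearly_stable (k : scalar_field) (X : seq_rule k) : Prop :=
  forall (E F : banach k) (T : E -> F),
    (summing X X T <-> is_linear T) /\
    (is_linear T -> summing_norm X X T = op_norm T).

(* X(K) embeds with norm 1 in Y(K): the condition under which the class of
   (X;Y)-summing operators is considered. *)
Definition admissible (k : scalar_field) (X Y : seq_rule k) : Prop :=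
  embeds1 X Y (scalar_banach k).

(* The index m = 0 is included; it only adds the norm of the null sequence. *)
Definition sup_trunc {k : scalar_field} (X : seq_rule k) {E : banach k}
    (x : nat -> E) : Rbar :=
  Sup_seq (fun m => Finite (snorm X (trunc m x))).

Definition finitely_determined (k : scalar_field) (X : seq_rule k) : Prop :=
  forall (E : banach k) (x : nat -> E),
    (smem X x <-> Rbar_lt (sup_trunc X x) p_infty) /\
    (smem X x -> Finite (snorm X x) = sup_trunc X x).

Definition finitely_shrinking (k : scalar_field) (X : seq_rule k) : Prop :=
  forall (E : banach k) (x : nat -> E) (m : nat), smem X x ->
    smem X (delete m x) /\ snorm X (delete m x) <= snorm X x.

Definition finitely_zero_invariant (k : scalar_field) (X : seq_rule k) : Prop :=
  forall (E : banach k) (x : nat -> E) (m : nat), x m = zero ->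
    (smem X x <-> smem X (delete m x)) /\
    (smem X x -> snorm X x = snorm X (delete m x)).

Definition Xu (k : scalar_field) (X : seq_rule k) : seq_rule k :=
  SeqRule (fun E x => smem X x /\ is_lim_seq (fun n => snorm X (tail n x)) 0)
          (fun E x => snorm X x).

Definition Xfd (k : scalar_field) (X : seq_rule k) : seq_rule k :=
  SeqRule (fun E x => Rbar_lt (sup_trunc X x) p_infty)
          (fun E x => real (sup_trunc X x)).

(* Main.v *)
Require Import Defs.
From Stdlib Require Import Reals Lra Lia Classical ClassicalEpsilon
  FunctionalExtensionality.
From Coquelicot Require Import Coquelicot.

(** Everything rests on one estimate. Suppose that T maps X^u(E) into Y^fd(F).
    The seminorms sending x to the Y-norm of the truncation of T x to its first
    m entries are continuous on X^u(E), by linear stability of Y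
    ([snorm_trunc_le_sup]), and pointwise bounded in m, by the definition of
    Y^fd. As X^u(E) is complete ([banach_Xu]), the uniform boundedness principle
    gives a constant C that bounds all of them by C ||x||
    ([summing_Xu_Xfd_bounded]). This replaces the closed graph theorem for the
    induced operator.

    Truncations of any x in X(E) lie in X^u(E), and have norm at most ||x|| when
    X is finitely determined; truncation also commutes with T. So the estimate
    passes from X^u(E) to X(E), and T maps X(E) into Y^fd(F). The two norms of T
    agree because the Y^fd-norm of T x is the supremum of the norms of its
    truncations, each of which is the image of an element of X^u(E) of no larger
    norm than x ([ideal_eq1_Xu_Xfd]). For Y finitely determined, Y and Y^fd have
    the same members and norms, and part (a) follows.

    For the range X^u -> Y^u the estimate is applied to the tails of x in X^u(E):
    the truncations of the n-th tail of T x have norm at most C times the norm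
    of the n-th tail of x, which tends to 0. If Y is finitely determined, this
    bounds the tails of T x, and (b) follows. If Y is only finitely shrinking
    and zero invariant, it first shows that the truncations of T x form a Cauchy
    sequence in Y(F), hence that T x is in Y(F), and then that its tails tend to
    0 ([smem_Xu_of_trunc_tails]). In the other direction, truncations on Y(F)
    have norm at most 2, so Y is contained in Y^fd; this gives (c). *)

Local Notation "x [+] y" := (fun n => plus (x n) (y n))
  (at level 50, left associativity).
Local Notation "x [-] y" := (fun n => minus (x n) (y n))
  (at level 50, left associativity).
Local Notation "a [*] x" := (fun n => scal a (x n))
  (at level 40, left associativity).

(** * Seminorms on a Banach space of sequences *)

Record seminorm_on {k : scalar_field} (Z : seq_rule k) (E : banach k)
    (p : (nat -> E) -> R) : Prop := {
  sn_plus : forall x y, smem Z x -> smem Z y -> p (x [+] y) <= p x + p y;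
  sn_scal : forall a x, smem Z x -> p (a [*] x) = abs a * p x
}.

Arguments seminorm_on {k} Z {E} p.

Lemma snorm_seminorm {k : scalar_field} {Z : seq_rule k} {E : banach k} :
  banach_seq_space Z E -> seminorm_on Z (@snorm k Z E).
Proof. intros h; split; [apply (bss_norm_triangle h) | apply (bss_norm_scal h)]. Qed.

(** The next two identities are stated for abstract groups so that they can be
    used in E by conversion: rewriting with group lemmas directly in E fails to
    match the several structures that E carries. *)
Lemma plus_minus_cancel {G : AbelianGroup} (x y : G) : plus y (minus x y) = x.
Proof.
  unfold minus; now rewrite (plus_comm x), plus_assoc, (plus_opp_r y), plus_zero_l.
Qed.

Lemma minus_plus_cancel {G : AbelianGroup} (x y : G) : minus (plus x y) x = y.
Proof.
  unfold minus; rewrite (plus_comm x), <- plus_assoc.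
  now change (plus y (plus x (opp x)) = y); rewrite plus_opp_r, plus_zero_r.
Qed.

Definition minus_one (k : scalar_field) : ring_of k := opp one.

Lemma abs_minus_one (k : scalar_field) : abs (minus_one k) = 1.
Proof. exact abs_opp_one. Qed.

Lemma scal_minus_one {k : scalar_field} {E : banach k} (x : E) :
  scal (minus_one k) x = opp x.
Proof. exact (scal_opp_one x). Qed.

Lemma seq_minus_opp {k : scalar_field} {E : banach k} (x y : nat -> E) :
  x [-] y = x [+] (minus_one k [*] y).
Proof.
  apply functional_extensionality; intro n; now rewrite scal_minus_one.
Qed.

Lemma smem_minus {k : scalar_field} {Z : seq_rule k} {E : banach k}
    (h : banach_seq_space Z E) (x y : nat -> E) :
  smem Z x -> smem Z y -> smem Z (x [-] y).
Proof.
  intros hx hy; rewrite seq_minus_opp.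
  now apply (bss_plus h); [| apply (bss_scal h)].
Qed.

Lemma sn_minus {k : scalar_field} {Z : seq_rule k} {E : banach k}
    (h : banach_seq_space Z E) {p : (nat -> E) -> R} (hp : seminorm_on Z p)
    (x y : nat -> E) :
  smem Z x -> smem Z y -> p (x [-] y) <= p x + p y.
Proof.
  intros hx hy; rewrite seq_minus_opp.
  eapply Rle_trans; [apply (sn_plus _ _ _ hp); auto; now apply (bss_scal h) |].
  rewrite (sn_scal _ _ _ hp), abs_minus_one by assumption; lra.
Qed.

Lemma sn_minus_sym {k : scalar_field} {Z : seq_rule k} {E : banach k}
    (h : banach_seq_space Z E) {p : (nat -> E) -> R} (hp : seminorm_on Z p)
    (x y : nat -> E) :
  smem Z x -> smem Z y -> p (x [-] y) = p (y [-] x).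
Proof.
  intros hx hy.
  replace (x [-] y) with (minus_one k [*] (y [-] x)).
  - rewrite (sn_scal _ _ _ hp), abs_minus_one by (now apply (smem_minus h)); lra.
  - apply functional_extensionality; intro n.
    now rewrite scal_minus_one, opp_minus.
Qed.

Lemma sn_dist_triangle {k : scalar_field} {Z : seq_rule k} {E : banach k}
    (h : banach_seq_space Z E) {p : (nat -> E) -> R} (hp : seminorm_on Z p)
    (x y z : nat -> E) :
  smem Z x -> smem Z y -> smem Z z ->
  p (x [-] z) <= p (x [-] y) + p (y [-] z).
Proof.
  intros hx hy hz.
  replace (x [-] z) with ((x [-] y) [+] (y [-] z)).
  - apply (sn_plus _ _ _ hp); now apply (smem_minus h).
  - apply functional_extensionality; intro n; symmetry; apply minus_trans.
Qed.

Lemma sn_le_dist {k : scalar_field} {Z : seq_rule k} {E : banach k}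
    (h : banach_seq_space Z E) {p : (nat -> E) -> R} (hp : seminorm_on Z p)
    (x y : nat -> E) :
  smem Z x -> smem Z y -> p x <= p y + p (x [-] y).
Proof.
  intros hx hy.
  replace x with (y [+] (x [-] y)) at 1.
  - apply (sn_plus _ _ _ hp); auto; now apply (smem_minus h).
  - apply functional_extensionality; intro n; exact (plus_minus_cancel (G := E) _ _).
Qed.

Lemma snorm_zero {k : scalar_field} {Z : seq_rule k} {E : banach k}
    (h : banach_seq_space Z E) :
  snorm Z (fun _ => zero : E) = 0.
Proof.
  replace (fun _ : nat => zero : E) with
    ((zero : ring_of k) [*] (fun _ : nat => zero : E)).
  - rewrite (bss_norm_scal h), abs_zero by apply (bss_zero h); lra.
  - apply functional_extensionality; intro n; exact (scal_zero_l (V := E) zero).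
Qed.

Lemma exists_scalar_abs (k : scalar_field) (t : R) :
  0 <= t -> exists a : ring_of k, abs a = t.
Proof.
  intros ht; destruct k.
  - exists t; now apply Rabs_pos_eq.
  - exists (RtoC t); change (Cmod (RtoC t) = t).
    now rewrite Cmod_R, Rabs_pos_eq.
Qed.

(** * The uniform boundedness principle *)

Lemma dependent_choice {S : Type} (r : nat -> S -> S -> Prop) (s0 : S) :
  (forall n s, exists s', r n s s') ->
  exists f : nat -> S, f 0%nat = s0 /\ forall n, r n (f n) (f (Datatypes.S n)).
Proof.
  intros h.
  set (step n s := constructive_indefinite_description _ (h n s)).
  exists (nat_rect (fun _ => S) s0 (fun n s => proj1_sig (step n s))).
  split; [reflexivity |].
  intros n; simpl; apply (proj2_sig (step n _)).
Qed.

(** A seminorm that is large at some z of norm r is large at x or at x + z, since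
    p z <= p x + p (x + z). So if the p m are not uniformly bounded on the unit
    ball, then they are not on any ball. The bound on each single p m excludes
    the vectors z of norm 0, which could not be scaled to norm r. *)
Lemma unbounded_on_balls {k : scalar_field} {Z : seq_rule k} {E : banach k}
    (h : banach_seq_space Z E) {p : nat -> (nat -> E) -> R}
    (hp : forall m, seminorm_on Z (p m))
    (hB : forall m, exists B, forall x, smem Z x -> p m x <= B * snorm Z x)
    (unb : forall C, 0 <= C ->
       exists m x, smem Z x /\ C * snorm Z x < p m x)
    (x : nat -> E) (r N : R) :
  smem Z x -> 0 < r -> 0 <= N ->
  exists m y, smem Z y /\ snorm Z (y [-] x) <= r /\ N < p m y.
Proof.
  intros hx hr hN.
  destruct (unb (2 * N / r)) as (m & z & hz & hmz).
  { apply Rmult_le_pos; [lra | left; now apply Rinv_0_lt_compat]. }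
  assert (hz0 : 0 < snorm Z z).
  { destruct (bss_norm_ge0 h hz) as [|e]; [assumption | exfalso].
    destruct (hB m) as [B hBm]; specialize (hBm z hz).
    rewrite <- e in hmz, hBm; lra. }
  destruct (exists_scalar_abs k (r / snorm Z z)) as [a ha].
  { left; now apply Rdiv_lt_0_compat. }
  assert (haz : smem Z (a [*] z)) by now apply (bss_scal h).
  assert (naz : snorm Z (a [*] z) = r).
  { rewrite (bss_norm_scal h), ha by assumption; field; lra. }
  assert (paz : 2 * N < p m (a [*] z)).
  { rewrite (sn_scal _ _ _ (hp m)), ha by assumption.
    replace (2 * N) with (r / snorm Z z * (2 * N / r * snorm Z z))
      by (field; lra).
    apply Rmult_lt_compat_l; [now apply Rdiv_lt_0_compat | assumption]. }
  destruct (Rlt_or_le N (p m x)) as [hpx | hpx].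
  - exists m, x; repeat split; auto.
    replace (x [-] x) with (fun _ : nat => zero : E).
    + rewrite (snorm_zero h); lra.
    + apply functional_extensionality; intro n; symmetry; apply (minus_eq_zero (G := E)).
  - exists m, (x [+] (a [*] z)).
    assert (e : (x [+] (a [*] z)) [-] x = a [*] z).
    { apply functional_extensionality; intro n; exact (minus_plus_cancel (G := E) _ _). }
    assert (hs : smem Z (x [+] (a [*] z))) by now apply (bss_plus h).
    repeat split; auto.
    + rewrite e, naz; lra.
    + pose proof (sn_minus h (hp m) _ _ hs hx) as hm.
      cbv beta in hm; rewrite e in hm; lra.
Qed.

(** Baire's argument made explicit: otherwise there are nested closed balls, with
    radii tending to 0, such that on the n-th one some p m exceeds n. The
    seminorms are unbounded at the common point of the balls. *)
Theorem uniform_boundedness {k : scalar_field} {Z : seq_rule k} {E : banach k}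
    (h : banach_seq_space Z E) {p : nat -> (nat -> E) -> R}
    (hp : forall m, seminorm_on Z (p m))
    (hB : forall m, exists B, forall x, smem Z x -> p m x <= B * snorm Z x)
    (pw : forall x, smem Z x -> exists M, forall m, p m x <= M) :
  exists C, 0 <= C /\ forall m x, smem Z x -> p m x <= C * snorm Z x.
Proof.
  apply NNPP; intros no.
  assert (unb : forall C, 0 <= C ->
    exists m x, smem Z x /\ C * snorm Z x < p m x).
  { intros C hC; apply NNPP; intros no'; apply no; exists C; split; auto.
    intros m x hx; apply Rnot_lt_le; intros hlt; apply no'; eauto. }
  set (ball := {s : (nat -> E) * R | smem Z (fst s) /\ 0 < snd s}).
  set (center (s : ball) := fst (proj1_sig s)).
  set (radius (s : ball) := snd (proj1_sig s)).
  assert (hc : forall s, smem Z (center s)) by (intros [[] []]; assumption).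
  assert (hr : forall s, 0 < radius s) by (intros [[] []]; assumption).
  set (step (n : nat) (s s' : ball) :=
    radius s' <= radius s / 2 /\ radius s' <= (/ 2) ^ n /\
    snorm Z (center s' [-] center s) <= radius s / 2 /\
    exists m, forall y, smem Z y ->
      snorm Z (y [-] center s') <= radius s' -> INR n < p m y).
  assert (hstep : forall n s, exists s', step n s s').
  { intros n s.
    destruct (unbounded_on_balls h hp hB unb (center s) (radius s / 2) (INR n))
      as (m & y & hy & hyx & hpy);
      [apply hc | pose proof (hr s); lra | apply pos_INR |].
    destruct (hB m) as [B hBm].
    (* p m still exceeds INR n within distance d of y, p m being |B|-Lipschitz;
       adding 1 to |B| keeps the quotient meaningful and the inequality strict. *)
    set (d := (p m y - INR n) / (Rabs B + 1)).
    assert (hB0 := Rabs_pos B).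
    assert (hd : 0 < d) by (apply Rdiv_lt_0_compat; lra).
    assert (h2 : 0 < (/ 2) ^ n) by (apply pow_lt; lra).
    pose proof (hr s) as hrs.
    set (r' := Rmin d (Rmin (radius s / 2) ((/ 2) ^ n))).
    assert (hr' : 0 < r') by (repeat apply Rmin_glb_lt; lra).
    assert (r'd : r' <= d) by apply Rmin_l.
    assert (r'm : r' <= Rmin (radius s / 2) ((/ 2) ^ n)) by apply Rmin_r.
    exists (exist _ (y, r') (conj hy hr')); repeat split; cbn.
    - eapply Rle_trans; [exact r'm | apply Rmin_l].
    - eapply Rle_trans; [exact r'm | apply Rmin_r].
    - assumption.
    - exists m; intros z hz hzy.
      assert (hyz : smem Z (y [-] z)) by now apply (smem_minus h).
      pose proof (sn_le_dist h (hp m) y z hy hz) as t1.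
      pose proof (hBm _ hyz) as t2.
      rewrite (sn_minus_sym h (snorm_seminorm h) y z) in t2 by assumption.
      assert (t3 : B * snorm Z (z [-] y) <= Rabs B * d).
      { apply Rle_trans with (Rabs B * snorm Z (z [-] y)).
        - apply Rmult_le_compat_r; [apply (bss_norm_ge0 h) | apply Rle_abs].
          now apply (smem_minus h).
        - apply Rmult_le_compat_l; [assumption |].
          now apply Rle_trans with r'. }
      assert (t4 : Rabs B * d = p m y - INR n - d) by (unfold d; field; lra).
      lra. }
  assert (s0 : ball).
  { exists (fun _ => zero, 1); split; [apply (bss_zero h) | simpl; lra]. }
  destruct (dependent_choice step s0 hstep) as (f & _ & hf).
  (* Each move is at most half of the current radius, and the radius is at least
     halved: so distance travelled plus remaining radius never increases. *)
  assert (nested : forall n i,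
    snorm Z (center (f (n + i)%nat) [-] center (f n))
      <= radius (f n) - radius (f (n + i)%nat)).
  { intros n i; induction i as [|i IH].
    - rewrite Nat.add_0_r.
      replace (center (f n) [-] center (f n)) with (fun _ : nat => zero : E).
      + rewrite (snorm_zero h); lra.
      + apply functional_extensionality; intro; symmetry; apply (minus_eq_zero (G := E)).
    - rewrite Nat.add_succ_r.
      destruct (hf (n + i)%nat) as (h1 & _ & h2 & _).
      pose proof (sn_dist_triangle h (snorm_seminorm h)
        (center (f (S (n + i)))) (center (f (n + i)%nat)) (center (f n))
        (hc _) (hc _) (hc _)).
      lra. }
  assert (near : forall n i, (n <= i)%nat ->
    snorm Z (center (f i) [-] center (f n)) <= radius (f n)).
  { intros n i hi; replace i with (n + (i - n))%nat by lia.
    pose proof (nested n (i - n)%nat); pose proof (hr (f (n + (i - n))%nat)).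
    lra. }
  destruct (bss_complete h (u := fun i => center (f i))) as (x & hx & limx).
  { intros i; apply hc. }
  { intros eps heps.
    destruct (pow_lt_1_zero (/ 2)) with (y := eps / 2) as [N hN].
    { rewrite Rabs_pos_eq; lra. }
    { lra. }
    exists (S N); intros i j hi hj.
    pose proof (near (S N) i hi) as ni; pose proof (near (S N) j hj) as nj.
    destruct (hf N) as (_ & hrN & _).
    pose proof (hN N (le_n N)) as hNN.
    rewrite Rabs_pos_eq in hNN by (apply pow_le; lra).
    pose proof (sn_dist_triangle h (snorm_seminorm h)
      (center (f i)) (center (f (S N))) (center (f j)) (hc _) (hc _) (hc _)).
    rewrite (sn_minus_sym h (snorm_seminorm h) (center (f (S N)))) in H
      by apply hc.
    lra. }
  assert (inball : forall n, snorm Z (x [-] center (f n)) <= radius (f n)).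
  { intros n; apply le_epsilon; intros eps heps.
    destruct (limx eps heps) as [N hN].
    pose proof (hN (Nat.max n N) (Nat.le_max_r _ _)) as t1.
    pose proof (near n _ (Nat.le_max_l n N)) as t2.
    pose proof (sn_dist_triangle h (snorm_seminorm h)
      x (center (f (Nat.max n N))) (center (f n)) hx (hc _) (hc _)) as t3.
    cbv beta in t1; rewrite (sn_minus_sym h (snorm_seminorm h)) in t1 by auto.
    lra. }
  destruct (pw x hx) as [M hM].
  destruct (INR_unbounded M) as [n hn].
  destruct (hf n) as (_ & _ & _ & m & hm).
  specialize (hm x hx (inball (S n))); specialize (hM m); lra.
Qed.

(** * Truncations, tails and the associated sequence rules *)

Definition single {k : scalar_field} {E : banach k} (j : nat) (y : E) :
    nat -> E :=
  fun n => if Nat.eqb n j then y else zero.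

Definition shift {k : scalar_field} {E : banach k} (n : nat) (y : nat -> E) :
    nat -> E :=
  fun j => if Nat.ltb j n then zero else y (j - n)%nat.

Lemma trunc_lt {k : scalar_field} {E : banach k} (m n : nat) (x : nat -> E) :
  (n < m)%nat -> trunc m x n = x n.
Proof. intros h; unfold trunc; now rewrite (proj2 (Nat.ltb_lt n m) h). Qed.

Lemma trunc_ge {k : scalar_field} {E : banach k} (m n : nat) (x : nat -> E) :
  (m <= n)%nat -> trunc m x n = zero.
Proof. intros h; unfold trunc; now rewrite (proj2 (Nat.ltb_ge n m) h). Qed.

Lemma trunc_eventually_null {k : scalar_field} {E : banach k} (m : nat)
    (x : nat -> E) :
  eventually_null (trunc m x).
Proof. exists m; intros n h; now apply trunc_ge. Qed.

Lemma trunc_succ {k : scalar_field} {E : banach k} (m : nat) (x : nat -> E) :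
  trunc (S m) x = trunc m x [+] single m (x m).
Proof.
  apply functional_extensionality; intro n; unfold single.
  destruct (Nat.eqb_spec n m) as [-> | ne].
  - rewrite trunc_lt, trunc_ge by lia; symmetry; exact (plus_zero_l (G := E) _).
  - transitivity (trunc m x n); [| symmetry; exact (plus_zero_r (G := E) _)].
    destruct (Nat.lt_ge_cases n m).
    + now rewrite !trunc_lt by lia.
    + now rewrite !trunc_ge by lia.
Qed.

Lemma trunc_plus {k : scalar_field} {E : banach k} (m : nat) (x y : nat -> E) :
  trunc m (x [+] y) = trunc m x [+] trunc m y.
Proof.
  apply functional_extensionality; intro n; unfold trunc.
  destruct (Nat.ltb n m); [reflexivity | symmetry; exact (plus_zero_l (G := E) _)].
Qed.

Lemma trunc_scal {k : scalar_field} {E : banach k} (m : nat) (a : ring_of k)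
    (x : nat -> E) :
  trunc m (a [*] x) = a [*] trunc m x.
Proof.
  apply functional_extensionality; intro n; unfold trunc.
  destruct (Nat.ltb n m); [reflexivity | symmetry; exact (scal_zero_r (V := E) a)].
Qed.

Lemma trunc_linear {k : scalar_field} {E F : banach k} {T : E -> F}
    (hT : is_linear T) (m : nat) (x : nat -> E) :
  (fun j => T (trunc m x j)) = trunc m (fun j => T (x j)).
Proof.
  apply functional_extensionality; intro n; unfold trunc.
  destruct (Nat.ltb n m); [reflexivity | apply (linear_zero T hT)].
Qed.

Lemma trunc_trunc {k : scalar_field} {E : banach k} (m : nat) (x : nat -> E) :
  trunc m (trunc m x) = trunc m x.
Proof.
  apply functional_extensionality; intro n; unfold trunc.
  now destruct (Nat.ltb n m).
Qed.

Lemma tail_succ {k : scalar_field} {E : banach k} (n : nat) (x : nat -> E) :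
  tail (S n) x = delete 0 (tail n x).
Proof.
  apply functional_extensionality; intro j; unfold tail, delete; cbn.
  f_equal; lia.
Qed.

Lemma tail_tail {k : scalar_field} {E : banach k} (n m : nat) (x : nat -> E) :
  tail m (tail n x) = tail (n + m) x.
Proof.
  apply functional_extensionality; intro j; unfold tail; f_equal; lia.
Qed.

Lemma tail_trunc {k : scalar_field} {E : banach k} (n m : nat) (x : nat -> E) :
  tail n (trunc (n + m) x) = trunc m (tail n x).
Proof.
  apply functional_extensionality; intro j; unfold tail.
  destruct (Nat.lt_ge_cases j m).
  - now rewrite !trunc_lt by lia.
  - now rewrite !trunc_ge by lia.
Qed.

Lemma minus_trunc {k : scalar_field} {E : banach k} (n m : nat)
    (x : nat -> E) :
  trunc (n + m) x [-] trunc n x = shift n (trunc m (tail n x)).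
Proof.
  apply functional_extensionality; intro j; unfold shift.
  destruct (Nat.ltb_spec j n).
  - rewrite !trunc_lt by lia; exact (minus_eq_zero (G := E) _).
  - rewrite (trunc_ge n) by lia.
    transitivity (trunc (n + m) x j); [exact (minus_zero_r (G := E) _) |].
    destruct (Nat.lt_ge_cases j (n + m)).
    + rewrite !trunc_lt by lia; unfold tail; f_equal; lia.
    + now rewrite !trunc_ge by lia.
Qed.

Lemma minus_shift_tail {k : scalar_field} {E : banach k} (n : nat)
    (x : nat -> E) :
  x [-] shift n (tail n x) = trunc n x.
Proof.
  apply functional_extensionality; intro j; unfold shift, tail.
  destruct (Nat.ltb_spec j n).
  - rewrite trunc_lt by lia; exact (minus_zero_r (G := E) _).
  - rewrite trunc_ge by lia; replace (n + (j - n))%nat with j by lia.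
    exact (minus_eq_zero (G := E) _).
Qed.

Lemma smem_trunc {k : scalar_field} {X : seq_rule k} {E : banach k}
    (hX : sequence_class X) (m : nat) (x : nat -> E) :
  smem X (trunc m x).
Proof. apply (sc_c00 hX), trunc_eventually_null. Qed.

Lemma norm_coord_le {k : scalar_field} {X : seq_rule k} {E : banach k}
    (hX : sequence_class X) (x : nat -> E) (n : nat) :
  smem X x -> norm (x n) <= snorm X x.
Proof.
  intros hx; destruct (sc_linf hX hx) as [[M hM] hle]; cbn in hle.
  set (u := fun n => Finite (norm (x n))) in *.
  assert (h1 : Rbar_le (u n) (Sup_seq u)).
  { apply is_sup_seq_major, Sup_seq_correct. }
  assert (h2 : Rbar_le (Sup_seq u) M).
  { apply (is_sup_seq_lub u _ (Sup_seq_correct u)); intros r [i ->]; apply hM. }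
  destruct (Sup_seq u); cbn in *; [lra | easy | easy].
Qed.

Lemma tail_shrinking {k : scalar_field} {X : seq_rule k} {E : banach k}
    (fsX : finitely_shrinking X) (n : nat) (x : nat -> E) :
  smem X x -> smem X (tail n x) /\ snorm X (tail n x) <= snorm X x.
Proof.
  intros hx; induction n as [|n [h1 h2]].
  - split; [exact hx | apply Rle_refl].
  - rewrite tail_succ; destruct (fsX E _ 0%nat h1); split; [assumption | lra].
Qed.

(** The n zeros put in front of y can be deleted one at a time. *)
Lemma shift_zero_invariant {k : scalar_field} {Y : seq_rule k} {E : banach k}
    (fzY : finitely_zero_invariant Y) (n : nat) (y : nat -> E) :
  smem Y y -> smem Y (shift n y) /\ snorm Y (shift n y) = snorm Y y.
Proof.
  intros hy; induction n as [|n [h1 h2]].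
  - replace (shift 0 y) with y; [now split |].
    apply functional_extensionality; intro j; unfold shift; cbn.
    now rewrite Nat.sub_0_r.
  - destruct (fzY E (shift (S n) y) 0%nat eq_refl) as [hm hn].
    change (delete 0 (shift (S n) y)) with (shift n y) in hm, hn.
    apply hm in h1; split; [assumption | now rewrite hn].
Qed.

Lemma le_sup_trunc {k : scalar_field} (X : seq_rule k) {E : banach k}
    (m : nat) (x : nat -> E) :
  Rbar_le (snorm X (trunc m x)) (sup_trunc X x).
Proof.
  apply (is_sup_seq_major (fun m => Finite (snorm X (trunc m x))) _ m).
  apply Sup_seq_correct.
Qed.

Lemma sup_trunc_le {k : scalar_field} (X : seq_rule k) {E : banach k}
    (x : nat -> E) (l : Rbar) :
  (forall m, Rbar_le (snorm X (trunc m x)) l) -> Rbar_le (sup_trunc X x) l.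
Proof.
  intros h; unfold sup_trunc.
  apply (is_sup_seq_lub _ _ (Sup_seq_correct _)); intros r [i ->]; apply h.
Qed.

Lemma smem_Xfd_of_bound {k : scalar_field} (X : seq_rule k) {E : banach k}
    (x : nat -> E) (M : R) :
  (forall m, snorm X (trunc m x) <= M) -> smem (Xfd X) x.
Proof.
  intros h; apply Rbar_le_lt_trans with (Finite M); [| easy].
  now apply sup_trunc_le.
Qed.

Lemma sup_trunc_Xfd {k : scalar_field} (X : seq_rule k) {E : banach k}
    (x : nat -> E) :
  smem (Xfd X) x -> Finite (snorm (Xfd X) x) = sup_trunc X x.
Proof.
  cbn; intros h.
  pose proof (le_sup_trunc X 0 x) as h0.
  now destruct (sup_trunc X x).
Qed.

Lemma snorm_trunc_le_Xfd {k : scalar_field} (X : seq_rule k) {E : banach k}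
    (m : nat) (x : nat -> E) :
  smem (Xfd X) x -> snorm X (trunc m x) <= snorm (Xfd X) x.
Proof.
  intros h; apply sup_trunc_Xfd in h.
  change (Rbar_le (snorm X (trunc m x)) (Finite (snorm (Xfd X) x))).
  rewrite h; apply le_sup_trunc.
Qed.

Lemma Xfd_of_finitely_determined {k : scalar_field} {X : seq_rule k}
    (fdX : finitely_determined X) {E : banach k} (x : nat -> E) :
  (smem X x <-> smem (Xfd X) x) /\
  (smem X x -> snorm X x = snorm (Xfd X) x).
Proof.
  destruct (fdX E x) as [h1 h2]; split; [exact h1 |].
  intros hx; cbn; now rewrite <- h2.
Qed.

Lemma snorm_trunc_le {k : scalar_field} {X : seq_rule k}
    (fdX : finitely_determined X) {E : banach k} (m : nat) (x : nat -> E) :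
  smem X x -> snorm X (trunc m x) <= snorm X x.
Proof.
  intros hx; destruct (Xfd_of_finitely_determined fdX x) as [h1 h2].
  rewrite h2 by assumption; now apply snorm_trunc_le_Xfd, h1.
Qed.

(** X^u(E) is a closed subspace of X(E): the norm of the n-th tail is a
    contraction in x, uniformly in n, so the tails of a limit of sequences with
    null tails are null. *)
Lemma banach_Xu {k : scalar_field} {X : seq_rule k} (hX : sequence_class X)
    (fsX : finitely_shrinking X) (E : banach k) :
  banach_seq_space (Xu X) E.
Proof.
  pose proof (sc_banach hX E) as h.
  split; cbn.
  - split; [apply (bss_zero h) |].
    apply is_lim_seq_ext with (fun _ => 0); [| apply is_lim_seq_const].
    intros n; symmetry; apply (snorm_zero h).
  - intros x y [hx lx] [hy ly]; split; [now apply (bss_plus h) |].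
    apply is_lim_seq_le_le with (fun _ => 0)
      (fun n => snorm X (tail n x) + snorm X (tail n y)).
    + intros n.
      pose proof (proj1 (tail_shrinking fsX n x hx)).
      pose proof (proj1 (tail_shrinking fsX n y hy)).
      split.
      * apply (bss_norm_ge0 h); now apply (bss_plus h (x := tail n x)).
      * now apply (bss_norm_triangle h (x := tail n x)).
    + apply is_lim_seq_const.
    + replace (Finite 0) with (Finite (0 + 0)) by (f_equal; lra).
      now apply is_lim_seq_plus'.
  - intros a x [hx lx]; split; [now apply (bss_scal h) |].
    apply is_lim_seq_ext with (fun n => abs a * snorm X (tail n x)).
    + intros n; symmetry; apply (bss_norm_scal h a (x := tail n x)).
      now apply tail_shrinking.
    + replace (Finite 0) with (Rbar_mult (abs a) 0)
        by (cbn; f_equal; lra).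
      now apply is_lim_seq_scal_l.
  - intros x [hx _]; now apply (bss_norm_ge0 h).
  - intros x [hx _]; now apply (bss_norm_eq0 h).
  - intros x y [hx _] [hy _]; now apply (bss_norm_triangle h).
  - intros a x [hx _]; now apply (bss_norm_scal h).
  - intros u hu cau.
    destruct (bss_complete h (fun i => proj1 (hu i)) cau) as (x & hx & lim).
    exists x; split; [split; [assumption |] | assumption].
    apply is_lim_seq_spec; intros eps.
    assert (heps := cond_pos eps).
    destruct (lim (eps / 2)) as [i hi]; [lra |].
    specialize (hi i (le_n i)).
    destruct (hu i) as [hui lui].
    destruct (proj2 (is_lim_seq_spec _ _) lui (mkposreal (eps / 2) ltac:(lra)))
      as [N hN]; cbn in hN.
    exists N; intros n hn; specialize (hN n hn).
    rewrite Rminus_0_r in *.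
    destruct (tail_shrinking fsX n x hx) as [hxn _].
    destruct (tail_shrinking fsX n _ hui) as [huin _].
    assert (hd : smem X (u i [-] x)) by now apply (smem_minus h).
    destruct (tail_shrinking fsX n _ hd) as [hdn ndn].
    rewrite Rabs_pos_eq in * by now apply (bss_norm_ge0 h).
    pose proof (sn_le_dist h (snorm_seminorm h) _ _ hxn huin) as t.
    rewrite (sn_minus_sym h (snorm_seminorm h)) in t by assumption.
    change (tail n (u i [-] x)) with (tail n (u i) [-] tail n x) in ndn.
    lra.
Qed.

Lemma smem_Xu_trunc {k : scalar_field} {X : seq_rule k}
    (hX : sequence_class X) {E : banach k} (m : nat) (x : nat -> E) :
  smem (Xu X) (trunc m x).
Proof.
  split; [now apply smem_trunc |].
  apply is_lim_seq_ext_loc with (fun _ => 0); [| apply is_lim_seq_const].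
  exists m; intros n hn; symmetry.
  replace (tail n (trunc m x)) with (fun _ : nat => zero : E).
  - apply snorm_zero, (sc_banach hX).
  - apply functional_extensionality; intro j; unfold tail.
    now rewrite trunc_ge by lia.
Qed.

Lemma smem_Xu_tail {k : scalar_field} {X : seq_rule k}
    (fsX : finitely_shrinking X) {E : banach k} (n : nat) (x : nat -> E) :
  smem (Xu X) x -> smem (Xu X) (tail n x).
Proof.
  intros [hx lx]; split; [now apply tail_shrinking |].
  apply is_lim_seq_ext with (fun i => snorm X (tail (i + n) x)).
  - intros i; now rewrite tail_tail, Nat.add_comm.
  - now apply -> (is_lim_seq_incr_n (fun i => snorm X (tail i x))).
Qed.

(** * Norm estimates from linear stability *)

(** The scalar Banach space and the ring of scalars have the same elements, but
    their types agree only once k is known. *)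
Definition to_scalar {k : scalar_field} : scalar_banach k -> ring_of k :=
  match k return scalar_banach k -> ring_of k with
  | Real_scalars => fun a => a
  | Complex_scalars => fun a => a
  end.

(** The operator a |-> a y from the scalars to F has norm at most ||y|| and sends
    the j-th unit sequence, of norm 1 in Y(K), to y placed at position j. Linear
    stability says that it acts from Y(K) to Y(F) with the same norm. *)
Lemma snorm_single_le {k : scalar_field} {Y : seq_rule k}
    (hY : sequence_class Y) (lsY : linearly_stable Y) {F : banach k}
    (j : nat) (y : F) :
  snorm Y (single j y) <= norm y.
Proof.
  set (T := fun a : scalar_banach k => scal (to_scalar a) y).
  assert (abs_to : forall a : scalar_banach k, abs (to_scalar a) = norm a).
  { destruct k; reflexivity. }
  assert (hT : is_linear T).
  { split.
    - intros a b; unfold T; destruct k; apply (scal_distr_r (V := F)).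
    - intros c a; unfold T; destruct k; symmetry;
        apply (scal_assoc (V := F)).
    - exists (norm y + 1); split; [pose proof (norm_ge_0 y); lra |].
      intros a; unfold T.
      eapply Rle_trans; [apply (norm_scal (V := F)) |].
      rewrite abs_to; pose proof (norm_ge_0 a); nra. }
  destruct (lsY _ _ T) as [_ hn]; specialize (hn hT).
  assert (op : Rbar_le (op_norm T) (norm y)).
  { apply (proj2 (Lub_Rbar_correct _)); intros r (a & ha & ->).
    eapply Rle_trans; [apply (norm_scal (V := F)) |].
    rewrite abs_to; pose proof (norm_ge_0 y); nra. }
  assert (mem : Rbar_le (snorm Y (single j y)) (summing_norm Y Y T)).
  { apply (proj1 (Lub_Rbar_correct _)); exists (unit_seq k j).
    repeat split.
    - apply (sc_c00 hY); exists (S j); intros n hn'; unfold unit_seq.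
      now rewrite (proj2 (Nat.eqb_neq n j)) by lia.
    - right; apply (sc_unit hY).
    - f_equal; apply functional_extensionality; intro n.
      unfold single, unit_seq, T; destruct (Nat.eqb n j); symmetry.
      + destruct k; apply (scal_one (V := F)).
      + destruct k; apply (scal_zero_l (V := F)). }
  rewrite hn in mem; exact (Rbar_le_trans _ _ _ mem op).
Qed.

Lemma snorm_trunc_le_sup {k : scalar_field} {Y : seq_rule k}
    (hY : sequence_class Y) (lsY : linearly_stable Y) {F : banach k}
    (m : nat) (y : nat -> F) (M : R) :
  (forall n, norm (y n) <= M) -> snorm Y (trunc m y) <= INR m * M.
Proof.
  intros hM; pose proof (sc_banach hY F) as h.
  induction m as [|m IH].
  - change (trunc 0 y) with (fun _ : nat => zero : F).
    rewrite (snorm_zero h); cbn; lra.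
  - rewrite trunc_succ, S_INR.
    eapply Rle_trans; [apply (bss_norm_triangle h) |].
    + now apply smem_trunc.
    + apply (sc_c00 hY); exists (S m); intros n hn; unfold single.
      now rewrite (proj2 (Nat.eqb_neq n m)) by lia.
    + pose proof (snorm_single_le hY lsY m (y m)).
      specialize (hM m); lra.
Qed.

(** * Summing operators and truncations *)

(** The seminorms of the uniform boundedness principle are here the Y-norms of
    truncations of T x; they are pointwise bounded exactly because T x is in
    Y^fd(F). *)
Lemma summing_Xfd_bounded {k : scalar_field} {Z Y : seq_rule k}
    {E F : banach k} {T : E -> F} (hZ : banach_seq_space Z E)
    (hZinf : forall (x : nat -> E) n, smem Z x -> norm (x n) <= snorm Z x)
    (hY : sequence_class Y) (lsY : linearly_stable Y) :
  summing Z (Xfd Y) T ->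
  exists C, 0 <= C /\ forall m (x : nat -> E), smem Z x ->
    snorm Y (trunc m (fun j => T (x j))) <= C * snorm Z x.
Proof.
  intros [hT hs]; pose proof (sc_banach hY F) as h.
  apply (uniform_boundedness hZ
    (p := fun m x => snorm Y (trunc m (fun j => T (x j))))).
  - intros m; split.
    + intros x y _ _.
      replace (trunc m (fun j => T (plus (x j) (y j)))) with
        (trunc m (fun j => T (x j)) [+] trunc m (fun j => T (y j))).
      * apply (bss_norm_triangle h); now apply smem_trunc.
      * rewrite <- trunc_plus; f_equal; apply functional_extensionality; intro j.
        symmetry; apply (linear_plus T hT).
    + intros a x _.
      replace (trunc m (fun j => T (scal a (x j)))) with
        (a [*] trunc m (fun j => T (x j))).
      * apply (bss_norm_scal h); now apply smem_trunc.
      * rewrite <- trunc_scal; f_equal; apply functional_extensionality; intro j.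
        symmetry; apply (linear_scal T hT).
  - intros m; destruct (linear_norm T hT) as (M & hM & hb).
    exists (INR m * M); intros x hx; rewrite Rmult_assoc.
    apply (snorm_trunc_le_sup hY lsY); intros n.
    eapply Rle_trans; [apply hb |].
    apply Rmult_le_compat_l; [lra | now apply hZinf].
  - intros x hx; exists (snorm (Xfd Y) (fun j => T (x j))); intros m.
    now apply snorm_trunc_le_Xfd, hs.
Qed.

Lemma summing_Xu_Xfd_bounded {k : scalar_field} {X Y : seq_rule k}
    {E F : banach k} {T : E -> F} (hX : sequence_class X)
    (fsX : finitely_shrinking X)
    (hY : sequence_class Y) (lsY : linearly_stable Y) :
  summing (Xu X) (Xfd Y) T ->
  exists C, 0 <= C /\ forall m (x : nat -> E), smem (Xu X) x ->
    snorm Y (trunc m (fun j => T (x j))) <= C * snorm X x.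
Proof.
  apply (summing_Xfd_bounded (Z := Xu X)); try assumption.
  - now apply banach_Xu.
  - intros x n [hx _]; now apply (norm_coord_le hX).
Qed.

Lemma summing_Xu {k : scalar_field} {X Y : seq_rule k} {E F : banach k}
    {T : E -> F} :
  summing X Y T -> summing (Xu X) Y T.
Proof. intros [hT hs]; split; [assumption | intros x [hx _]; auto]. Qed.

(** Here [trunc m] is idempotent and commutes with T, so the m-th truncation of
    T x is that of T applied to the m-th truncation of x, which is in X^u(E). *)
Lemma ideal_eq1_Xu_Xfd {k : scalar_field} {X Y : seq_rule k}
    (hX : sequence_class X) (fdX : finitely_determined X)
    (fsX : finitely_shrinking X)
    (hY : sequence_class Y) (lsY : linearly_stable Y) :
  ideal_eq1 X (Xfd Y) (Xu X) (Xfd Y).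
Proof.
  split.
  - intros E F T; split; [apply summing_Xu |].
    intros hT; destruct (summing_Xu_Xfd_bounded hX fsX hY lsY hT)
      as (C & hC & hb).
    split; [apply hT |].
    intros x hx; apply smem_Xfd_of_bound with (C * snorm X x); intros m.
    rewrite <- trunc_trunc, <- (trunc_linear (proj1 hT)).
    eapply Rle_trans; [apply hb; now apply smem_Xu_trunc |].
    apply Rmult_le_compat_l; [assumption | now apply snorm_trunc_le].
  - intros E F T hT; apply Rbar_le_antisym.
    + apply (proj2 (Lub_Rbar_correct _)); intros r (x & hx & nx & ->).
      rewrite sup_trunc_Xfd by now apply hT.
      apply sup_trunc_le; intros m.
      apply Rbar_le_trans with
        (Finite (snorm (Xfd Y) (fun j => T (trunc m x j)))).
      * rewrite <- trunc_trunc, <- (trunc_linear (proj1 hT)).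
        apply (snorm_trunc_le_Xfd Y), hT; now apply smem_trunc.
      * apply (proj1 (Lub_Rbar_correct _)); exists (trunc m x); repeat split.
        -- now apply smem_trunc.
        -- now apply smem_Xu_trunc.
        -- eapply Rle_trans; [now apply (snorm_trunc_le fdX) | assumption].
    + apply (proj2 (Lub_Rbar_correct _)); intros r (x & [hx _] & nx & ->).
      apply (proj1 (Lub_Rbar_correct _)); eauto.
Qed.

Lemma summing_finitely_determined {k : scalar_field} {Z Y : seq_rule k}
    (fdY : finitely_determined Y) {E F : banach k} (T : E -> F) :
  summing Z Y T <-> summing Z (Xfd Y) T.
Proof.
  split; intros [hT hs]; split; auto; intros x hx;
    apply (Xfd_of_finitely_determined fdY); auto.
Qed.

Lemma summing_norm_finitely_determined {k : scalar_field} {Z Y : seq_rule k}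
    (fdY : finitely_determined Y) {E F : banach k} (T : E -> F) :
  summing Z Y T -> summing_norm Z Y T = summing_norm Z (Xfd Y) T.
Proof.
  intros [_ hs]; apply Lub_Rbar_eqset; intros r.
  split; intros (x & hx & nx & ->); exists x; repeat split; auto.
  - now apply (Xfd_of_finitely_determined fdY), hs.
  - symmetry; now apply (Xfd_of_finitely_determined fdY), hs.
Qed.

Lemma ideal_eq1_Xu {k : scalar_field} {X Y : seq_rule k}
    (hX : sequence_class X) (fdX : finitely_determined X)
    (fsX : finitely_shrinking X)
    (hY : sequence_class Y) (lsY : linearly_stable Y)
    (fdY : finitely_determined Y) :
  ideal_eq1 X Y (Xu X) Y.
Proof.
  destruct (ideal_eq1_Xu_Xfd hX fdX fsX hY lsY) as [he hn].
  split.
  - intros E F T; now rewrite !(summing_finitely_determined fdY).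
  - intros E F T hT.
    rewrite (summing_norm_finitely_determined fdY T hT).
    rewrite (summing_norm_finitely_determined fdY T (summing_Xu hT)).
    apply hn; now rewrite <- (summing_finitely_determined fdY).
Qed.

(** * Null tails of the image sequences *)

(** The norm in Y of a tail of T x is the supremum over its truncations, hence at
    most C times the norm of the same tail of x. *)
Lemma summing_Xu_Xu_of_finitely_determined {k : scalar_field}
    {X Y : seq_rule k} (hX : sequence_class X) (fsX : finitely_shrinking X)
    (hY : sequence_class Y) (lsY : linearly_stable Y)
    (fdY : finitely_determined Y) (fsY : finitely_shrinking Y)
    {E F : banach k} (T : E -> F) :
  summing (Xu X) Y T <-> summing (Xu X) (Xu Y) T.
Proof.
  split; intros hT; [| split; [apply hT | intros x hx; now apply hT]].
  assert (hT' : summing (Xu X) (Xfd Y) T).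
  { now rewrite <- (summing_finitely_determined fdY). }
  destruct (summing_Xu_Xfd_bounded hX fsX hY lsY hT') as (C & hC & hb).
  split; [apply hT |]; intros x hx; split; [now apply hT |].
  apply is_lim_seq_le_le with (fun _ => 0) (fun n => C * snorm X (tail n x)).
  - intros n; destruct hT as [_ hs].
    pose proof (hs _ (smem_Xu_tail fsX n x hx)) as hm.
    change (fun j => T (tail n x j)) with (tail n (fun j => T (x j))) in hm.
    split; [now apply (bss_norm_ge0 (sc_banach hY F)) |].
    destruct (fdY F (tail n (fun j => T (x j)))) as [_ hsup].
    change (Rbar_le (Finite (snorm Y (tail n (fun j => T (x j)))))
      (Finite (C * snorm X (tail n x)))).
    rewrite hsup by assumption; apply sup_trunc_le; intros m.
    apply (hb m (tail n x)); now apply smem_Xu_tail.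
  - apply is_lim_seq_const.
  - replace (Finite 0) with (Rbar_mult C 0) by (cbn; f_equal; lra).
    apply is_lim_seq_scal_l, hx.
Qed.

(** The m-th truncation of y is y minus its m-th tail preceded by m zeros. By zero
    invariance and shrinking the latter has norm at most that of y. *)
Lemma smem_Xfd_of_zero_invariant {k : scalar_field} {Y : seq_rule k}
    (hY : sequence_class Y) (fsY : finitely_shrinking Y)
    (fzY : finitely_zero_invariant Y) {F : banach k} (y : nat -> F) :
  smem Y y -> smem (Xfd Y) y.
Proof.
  intros hy; pose proof (sc_banach hY F) as h.
  apply smem_Xfd_of_bound with (snorm Y y + snorm Y y); intros m.
  destruct (tail_shrinking fsY m y hy) as [ht nt].
  destruct (shift_zero_invariant fzY m _ ht) as [hs ns].
  rewrite <- minus_shift_tail.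
  eapply Rle_trans; [apply (sn_minus h (snorm_seminorm h)); assumption |].
  rewrite ns; lra.
Qed.

(** By zero invariance the difference of the truncations of z of orders n + m and
    n has the norm of the m-th truncation of the n-th tail, at most c n. So the
    truncations converge in Y(F), and the limit is z because convergence in Y(F)
    is coordinatewise. Then the n-th tail of z is the limit of its truncations,
    so that its norm is at most c n as well. *)
Lemma smem_Xu_of_trunc_tails {k : scalar_field} {Y : seq_rule k}
    (hY : sequence_class Y) (fsY : finitely_shrinking Y)
    (fzY : finitely_zero_invariant Y) {F : banach k} (z : nat -> F)
    (c : nat -> R) :
  (forall n m, snorm Y (trunc m (tail n z)) <= c n) -> is_lim_seq c 0 ->
  smem (Xu Y) z.
Proof.
  intros hc lc; pose proof (sc_banach hY F) as h.
  assert (htr : forall m, smem Y (trunc m z)) by (intros; now apply smem_trunc).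
  assert (close : forall n i, (n <= i)%nat ->
    snorm Y (trunc i z [-] trunc n z) <= c n).
  { intros n i hi; replace i with (n + (i - n))%nat by lia.
    rewrite minus_trunc.
    rewrite (proj2 (shift_zero_invariant fzY n _ (smem_trunc hY _ _))).
    apply hc. }
  destruct (bss_complete h (u := fun i => trunc i z)) as (w & hw & lim).
  { assumption. }
  { intros eps heps.
    destruct (proj2 (is_lim_seq_spec _ _) lc (mkposreal (eps / 2) ltac:(lra)))
      as [N hN]; cbn in hN.
    specialize (hN N (le_n N)); rewrite Rminus_0_r in hN.
    apply Rabs_lt_between in hN.
    exists N; intros i j hi hj.
    pose proof (close N i hi) as ci; pose proof (close N j hj) as cj.
    pose proof (sn_dist_triangle h (snorm_seminorm h)
      (trunc i z) (trunc N z) (trunc j z) (htr _) (htr _) (htr _)) as t.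
    rewrite (sn_minus_sym h (snorm_seminorm h) (trunc N z)) in t by auto.
    lra. }
  assert (e : w = z).
  { apply functional_extensionality; intro n.
    assert (d0 : minus (z n) (w n) = zero).
    { apply (norm_eq_zero (V := F)), Rle_antisym; [| apply norm_ge_0].
      apply le_epsilon; intros eps heps; rewrite Rplus_0_l.
      destruct (lim eps heps) as [N hN].
      specialize (hN (Nat.max N (S n)) (Nat.le_max_l _ _)).
      pose proof (norm_coord_le hY _ n
        (smem_minus h _ _ (htr (Nat.max N (S n))) hw)) as t.
      cbv beta in t; rewrite (trunc_lt _ n) in t by lia; lra. }
    pose proof (plus_minus_cancel (G := F) (z n) (w n)) as t.
    rewrite <- t.
    transitivity (plus (w n) zero); [symmetry; exact (plus_zero_r (G := F) _) |].
    now f_equal. }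
  subst w; split; [assumption |].
  apply is_lim_seq_le_le with (fun _ => 0) c;
    [| apply is_lim_seq_const | assumption].
  intros n; destruct (tail_shrinking fsY n z hw) as [hn _].
  split; [now apply (bss_norm_ge0 h) |].
  apply le_epsilon; intros eps heps.
  destruct (lim eps heps) as [N hN].
  specialize (hN (n + N)%nat ltac:(lia)).
  assert (hd : smem Y (trunc (n + N) z [-] z)) by now apply (smem_minus h).
  destruct (tail_shrinking fsY n _ hd) as [_ ndn].
  change (tail n (trunc (n + N) z [-] z)) with
    (tail n (trunc (n + N) z) [-] tail n z) in ndn.
  rewrite tail_trunc in ndn.
  assert (hnN : smem Y (trunc N (tail n z))) by now apply smem_trunc.
  pose proof (sn_le_dist h (snorm_seminorm h) _ _ hn hnN) as t.
  rewrite (sn_minus_sym h (snorm_seminorm h)) in t by assumption.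
  specialize (hc n N); lra.
Qed.

Lemma summing_Xu_Xu_of_zero_invariant {k : scalar_field} {X Y : seq_rule k}
    (hX : sequence_class X) (fsX : finitely_shrinking X)
    (hY : sequence_class Y) (lsY : linearly_stable Y)
    (fsY : finitely_shrinking Y) (fzY : finitely_zero_invariant Y)
    {E F : banach k} (T : E -> F) :
  summing (Xu X) (Xu Y) T <-> summing (Xu X) (Xfd Y) T.
Proof.
  split; intros hT; (split; [apply hT | intros x hx]).
  - now apply smem_Xfd_of_zero_invariant; [.. | apply hT].
  - destruct (summing_Xu_Xfd_bounded hX fsX hY lsY hT) as (C & hC & hb).
    apply (smem_Xu_of_trunc_tails hY fsY fzY)
      with (c := fun n => C * snorm X (tail n x)).
    + intros n m; apply (hb m (tail n x)); now apply smem_Xu_tail.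
    + replace (Finite 0) with (Rbar_mult C 0) by (cbn; f_equal; lra).
      apply is_lim_seq_scal_l, hx.
Qed.

(** * The equalities of operator ideals *)

Theorem proposition6p1 (k : scalar_field) (X : seq_rule k)
    (hX : sequence_class X) (lsX : linearly_stable X)
    (fdX : finitely_determined X) (fsX : finitely_shrinking X) :
  (forall Y : seq_rule k, sequence_class Y -> linearly_stable Y ->
     admissible X Y -> admissible (Xu X) Y ->
     finitely_determined Y ->
     ideal_eq1 X Y (Xu X) Y) /\
  (forall Y : seq_rule k, sequence_class Y -> linearly_stable Y ->
     admissible X Y -> admissible (Xu X) (Xu Y) ->
     finitely_determined Y -> finitely_shrinking Y ->
     ideal_eq1 X Y (Xu X) (Xu Y)) /\
  (forall Y : seq_rule k, sequence_class Y -> linearly_stable Y ->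
     admissible (Xu X) (Xu Y) -> admissible X (Xfd Y) ->
     admissible (Xu X) (Xfd Y) ->
     finitely_shrinking Y -> finitely_zero_invariant Y ->
     ideal_eq (Xu X) (Xu Y) X (Xfd Y) /\
     ideal_eq1 X (Xfd Y) (Xu X) (Xfd Y)).
Proof.
  split; [| split].
  - intros Y hY lsY _ _ fdY; now apply ideal_eq1_Xu.
  - intros Y hY lsY _ _ fdY fsY.
    destruct (ideal_eq1_Xu hX fdX fsX hY lsY fdY) as [he hn].
    split; [| exact hn].
    intros E F T; rewrite (he E F T).
    now apply summing_Xu_Xu_of_finitely_determined.
  - intros Y hY lsY _ _ _ fsY fzY.
    pose proof (ideal_eq1_Xu_Xfd hX fdX fsX hY lsY) as he.
    split; [| exact he].
    intros E F T; rewrite (proj1 he E F T).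
    now apply summing_Xu_Xu_of_zero_invariant.
Qed.
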